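(* Let $z_{xx}=R(x,y,z,z_x,z_y,z_{xy})$, $z_{yy}=T(x,y,z,z_x,z_y,z_{xy})$ be a pair of PDEs satisfying $D_x^2T=D_y^2R$ and $1-R_sT_s>0$. A necessary condition for this pair to admit lifted forms $$\begin{pmatrix}\theta^4\\ \theta^1\\ \theta^2\\ \theta^3\\ \Omega_3\\ \Omega_2\end{pmatrix}=\begin{pmatrix}a&0&0&0&0&0\\ b_1&f_{11}&f_{12}&f_{13}&0&0\\ b_2&f_{21}&f_{22}&f_{23}&0&0\\ b_3&f_{31}&f_{32}&f_{33}&0&0\\ c_1&0&0&0&h_{11}&h_{12}\\ c_2&0&0&0&h_{21}&h_{22}\end{pmatrix}\begin{pmatrix}\lambda\\ \nu_1\\ \nu_2\\ \nu_3\\ \mu_1\\ \mu_2\end{pmatrix},\qquad a\det(f_{ij})\det(h_{ij})\neq0,$$ satisfying $$\begin{aligned} &d\theta^4\wedge\theta^4=(\Omega_2\wedge\theta^1+\Omega_3\wedge\theta^2)\wedge\theta^4,\\ &d\theta^1\wedge\theta^1\wedge\theta^2\wedge\theta^4\wedge\Omega_3=0,\qquad d\theta^2\wedge\theta^1\wedge\theta^2\wedge\theta^4\wedge\Omega_2=0,\\ &d\theta^1\wedge\theta^1\wedge\theta^3\wedge\theta^4\wedge\Omega_3=0,\qquad d\theta^2\wedge\theta^2\wedge\theta^3\wedge\theta^4\wedge\Omega_2=0 \end{aligned}$$ is that $R$ and $T$ satisfy $J_1\equiv0$ and $J_2\equiv0$, where $$\begin{aligned} J_1={}&(R_sT_s-4)D_xR_s+R_s(2D_yR_s-R_sD_xT_s)+8R_q-6R_qR_sT_s+4R_pR_s\\&+2R_s^2T_q-2R_pR_s^2T_s+2R_s^3T_p,\\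 J_2={}&(R_sT_s-4)D_yT_s+T_s(2D_xT_s-T_sD_yR_s)+8T_p-6R_sT_pT_s+4T_qT_s\\&+2R_pT_s^2-2R_sT_qT_s^2+2R_qT_s^3. \end{aligned}$$
   Context: $R$ and $T$ are smooth real functions of $(x,y,z,p,q,s)$, coordinates on the 6-dimensional jet space $\mathcal J$, where $p=z_x$, $q=z_y$, $s=z_{xy}$; letter subscripts on $R,T$ denote partial derivatives. The operators $$D_x=\partial_x+p\partial_z+R\partial_p+s\partial_q+(D_yR)\partial_s,\qquad D_y=\partial_y+q\partial_z+s\partial_p+T\partial_q+(D_xT)\partial_s$$ are defined with the functions $D_yR,D_xT$ being the unique solution (for $R_sT_s\ne1$) of the linear system $D_xT=T_x+pT_z+RT_p+sT_q+(D_yR)T_s$, $D_yR=R_y+qR_z+sR_p+TR_q+(D_xT)R_s$. $D_xR_s$ means $D_x$ applied to $R_s$, etc. The forms on $\mathcal J$ are $\lambda=dz-p\,dx-q\,dy$, $\mu_1=dx$, $\mu_2=dy$, $\nu_1=dp-R\,dx-s\,dy$, $\nu_2=dq-s\,dx-T\,dy$, $\nu_3=ds-D_yR\,dx-D_xT\,dy$. The coefficients $a,b_i,c_i,f_{ij},h_{ij}$ of the lifted forms are treated as (possibly restricted) group parameters, so the lifted forms live on a manifold fibred over $\mathcal J$. *)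

(* Defs.v *)
From HB Require Import structures.
From mathcomp Require Import all_boot all_order all_algebra.
From mathcomp Require Import all_classical all_reals all_analysis.
Import Order.TTheory GRing.Theory Num.Theory numFieldNormedType.Exports.

Set Implicit Arguments.
Unset Strict Implicit.
Unset Printing Implicit Defensive.

Local Open Scope classical_set_scope.
Local Open Scope ring_scope.

Definition partial (K : realType) (n : nat) (i : 'I_n) (F : 'rV[K]_n -> K) :
    'rV[K]_n -> K :=
  fun v => 'D_(delta_mx 0 i) F v.

(* C^oo on an open set: F and all its iterated partial derivatives are
   Frechet differentiable there. *)
Definition smooth_on (K : realType) (n : nat) (U : set 'rV[K]_n)
    (F : 'rV[K]_n -> K) : Prop :=
  forall (l : seq 'I_n) (v : 'rV[K]_n), U v ->
    differentiable (foldr (@partial K n) F l) v.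

(* Differential forms on (open subsets of) K^n.  The exterior algebra of the
   cotangent space is written in the basis dx_S = dx_{i1} /\ ... /\ dx_{ir},
   S = {i1 < ... < ir}; the value of a form at a point is its family of
   coefficients indexed by S. *)
Definition diff_form (K : realType) (n : nat) : Type :=
  'rV[K]_n -> {ffun {set 'I_n} -> K}.

(* dx_A /\ dx_B = (-1)^r dx_(A u B) for disjoint A and B, where r is the number
   of pairs i \in A, j \in B with j < i. *)
Definition shuffle_sign (K : realType) (n : nat) (A B : {set 'I_n}) : K :=
  (-1) ^+ #|[set ij : 'I_n * 'I_n |
              [&& ij.1 \in A, ij.2 \in B & (ij.2 < ij.1)%N]]%SET|.

Definition wedge (K : realType) (n : nat) (w e : diff_form K n) : diff_form K n :=
  fun v => [ffun S : {set 'I_n} =>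
    \sum_(A in powerset S) shuffle_sign K A (S :\: A) * w v A * e v (S :\: A)].

Notation "w \wedge e" := (wedge w e) (at level 40, left associativity).

Definition dcoord (K : realType) (n : nat) (i : 'I_n) : diff_form K n :=
  fun _ => [ffun S : {set 'I_n} => (S == [set i]%SET)%:R].

(* dw = \sum_i dx_i /\ (D_i w), with D_i acting on the coefficients. *)
Definition ext_d (K : realType) (n : nat) (w : diff_form K n) : diff_form K n :=
  fun v => \sum_(i < n)
    (dcoord i \wedge
       (fun u => [ffun S : {set 'I_n} => partial i (fun t => w t S) u])) v.

Definition jx : 'I_6 := @Ordinal 6 0 isT.
Definition jy : 'I_6 := @Ordinal 6 1 isT.
Definition jz : 'I_6 := @Ordinal 6 2 isT.
Definition jp : 'I_6 := @Ordinal 6 3 isT.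
Definition jq : 'I_6 := @Ordinal 6 4 isT.
Definition js : 'I_6 := @Ordinal 6 5 isT.

(* The arguments DyR and DxT below are the functions D_yR and D_xT on the jet
   space; they are tied to R and T by total_derivative_system. *)
Definition Dx (K : realType) (R DyR F : 'rV[K]_6 -> K) : 'rV[K]_6 -> K :=
  fun P => partial jx F P + P 0 jp * partial jz F P + R P * partial jp F P
           + P 0 js * partial jq F P + DyR P * partial js F P.

Definition Dy (K : realType) (T DxT F : 'rV[K]_6 -> K) : 'rV[K]_6 -> K :=
  fun P => partial jy F P + P 0 jq * partial jz F P + P 0 js * partial jp F P
           + T P * partial jq F P + DxT P * partial js F P.

(* At each point this is a linear system for the pair (DxT P, DyR P), of
   determinant 1 - R_s T_s. *)
Definition total_derivative_system (K : realType) (U : set 'rV[K]_6)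
    (R T DyR DxT : 'rV[K]_6 -> K) : Prop :=
  forall P, U P -> DxT P = Dx R DyR T P /\ DyR P = Dy T DxT R P.

Definition J1 (K : realType) (R T DyR DxT : 'rV[K]_6 -> K) : 'rV[K]_6 -> K :=
  fun P =>
  let R_p := partial jp R P in let R_q := partial jq R P in
  let T_p := partial jp T P in let T_q := partial jq T P in
  let R_s := partial js R P in let T_s := partial js T P in
  let DxR_s := Dx R DyR (partial js R) P in
  let DyR_s := Dy T DxT (partial js R) P in
  let DxT_s := Dx R DyR (partial js T) P in
  (R_s * T_s - 4) * DxR_s + R_s * (2 * DyR_s - R_s * DxT_s)
  + 8 * R_q - 6 * R_q * R_s * T_s + 4 * R_p * R_s
  + 2 * R_s ^+ 2 * T_q - 2 * R_p * R_s ^+ 2 * T_s + 2 * R_s ^+ 3 * T_p.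

Definition J2 (K : realType) (R T DyR DxT : 'rV[K]_6 -> K) : 'rV[K]_6 -> K :=
  fun P =>
  let R_p := partial jp R P in let R_q := partial jq R P in
  let T_p := partial jp T P in let T_q := partial jq T P in
  let R_s := partial js R P in let T_s := partial js T P in
  let DyR_s := Dy T DxT (partial js R) P in
  let DxT_s := Dx R DyR (partial js T) P in
  let DyT_s := Dy T DxT (partial js T) P in
  (R_s * T_s - 4) * DyT_s + T_s * (2 * DxT_s - T_s * DyR_s)
  + 8 * T_p - 6 * R_s * T_p * T_s + 4 * T_q * T_s
  + 2 * R_p * T_s ^+ 2 - 2 * R_s * T_q * T_s ^+ 2 + 2 * R_q * T_s ^+ 3.

(* Manifolds of dimension 6 + k fibred over the open set U of the jet space.
   The atlas consists of charts adapted to the fibration: the first six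
   coordinates are those of the base point.  A chart i is given by its
   parametrisation [param i], defined on [dom i], and by its coordinate map
   [coords i], defined on the image of [param i]. *)
Record fibred_manifold (K : realType) (U : set 'rV[K]_6) (k : nat) :=
    FibredManifold {
  total_space : topologicalType ;
  base_point : total_space -> 'rV[K]_6 ;
  chart : Type ;
  dom : chart -> set 'rV[K]_(6 + k) ;
  param : chart -> 'rV[K]_(6 + k) -> total_space ;
  coords : chart -> total_space -> 'rV[K]_(6 + k) ;
  space_hausdorff : hausdorff_space total_space ;
  space_second_countable : @second_countable total_space ;
  dom_open : forall i, open (dom i) ;
  image_open : forall i, open (param i @` dom i) ;
  paramK : forall i v, dom i v -> coords i (param i v) = v ;
  param_continuous : forall i v, dom i v -> {for v, continuous (param i)} ;
  coords_continuous : forall i m, (param i @` dom i) m ->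
    {for m, continuous (coords i)} ;
  charts_cover : forall m, exists i, (param i @` dom i) m ;
  transition_smooth : forall i j c,
    smooth_on (dom i `&` param i @^-1` (param j @` dom j))
              (fun v => coords j (param i v) 0 c) ;
  charts_adapted : forall i v, dom i v -> base_point (param i v) = lsubmx v ;
  base_point_onto : range base_point = U }.

Definition smooth_fun (K : realType) (U : set 'rV[K]_6) (k : nat)
    (M : fibred_manifold U k) (g : total_space M -> K) : Prop :=
  forall i, smooth_on (dom i) (g \o @param K U k M i).

(* The forms lambda, mu_i, nu_i of the jet space, pulled back to an adapted
   chart. *)
Section jet_forms.
Context (K : realType) (k : nat).
Implicit Types (R T DyR DxT : 'rV[K]_6 -> K) (v : 'rV[K]_(6 + k)).

Let dj (i : 'I_6) : diff_form K (6 + k) := dcoord (lshift k i).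

Definition lambda : diff_form K (6 + k) := fun v =>
  dj jz v - lsubmx v 0 jp *: dj jx v - lsubmx v 0 jq *: dj jy v.

Definition mu1 : diff_form K (6 + k) := dj jx.

Definition mu2 : diff_form K (6 + k) := dj jy.

Definition nu1 R : diff_form K (6 + k) := fun v =>
  dj jp v - R (lsubmx v) *: dj jx v - lsubmx v 0 js *: dj jy v.

Definition nu2 T : diff_form K (6 + k) := fun v =>
  dj jq v - lsubmx v 0 js *: dj jx v - T (lsubmx v) *: dj jy v.

Definition nu3 DyR DxT : diff_form K (6 + k) := fun v =>
  dj js v - DyR (lsubmx v) *: dj jx v - DxT (lsubmx v) *: dj jy v.

End jet_forms.

(* The coefficients of the lifted forms, as functions on a space S:
   b, f and c, h are the blocks of the rows (theta^1, theta^2, theta^3) and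
   (Omega_3, Omega_2) respectively. *)
Record coefficients (K : realType) (S : Type) := Coefficients {
  ca : S -> K ;
  cb : S -> 'cV[K]_3 ;
  cc : S -> 'cV[K]_2 ;
  cf : S -> 'M[K]_3 ;
  ch : S -> 'M[K]_2 }.

Definition pull_coefficients (K : realType) (S S' : Type) (phi : S' -> S)
    (g : coefficients K S) : coefficients K S' :=
  Coefficients (ca g \o phi) (cb g \o phi) (cc g \o phi)
               (cf g \o phi) (ch g \o phi).

Definition smooth_coefficients (K : realType) (U : set 'rV[K]_6) (k : nat)
    (M : fibred_manifold U k) (g : coefficients K (total_space M)) : Prop :=
  [/\ smooth_fun (ca g),
      forall i, smooth_fun (fun m => cb g m i 0),
      forall i, smooth_fun (fun m => cc g m i 0),
      forall i j, smooth_fun (fun m => cf g m i j)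
    & forall i j, smooth_fun (fun m => ch g m i j)].

Section lifted_forms.
Context (K : realType) (k : nat) (R T DyR DxT : 'rV[K]_6 -> K).
Context (g : coefficients K 'rV[K]_(6 + k)).

Definition theta4 : diff_form K (6 + k) := fun v => ca g v *: lambda v.

Definition theta_row (i : 'I_3) : diff_form K (6 + k) := fun v =>
  cb g v i 0 *: lambda v
  + cf g v i (@Ordinal 3 0 isT) *: nu1 R v
  + cf g v i (@Ordinal 3 1 isT) *: nu2 T v
  + cf g v i (@Ordinal 3 2 isT) *: nu3 DyR DxT v.

Definition Omega_row (i : 'I_2) : diff_form K (6 + k) := fun v =>
  cc g v i 0 *: lambda v
  + ch g v i (@Ordinal 2 0 isT) *: mu1 v
  + ch g v i (@Ordinal 2 1 isT) *: mu2 v.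

Definition structure_equations (v : 'rV[K]_(6 + k)) : Prop :=
  let theta1 := theta_row (@Ordinal 3 0 isT) in
  let theta2 := theta_row (@Ordinal 3 1 isT) in
  let theta3 := theta_row (@Ordinal 3 2 isT) in
  let Omega3 := Omega_row (@Ordinal 2 0 isT) in
  let Omega2 := Omega_row (@Ordinal 2 1 isT) in
  [/\ (ext_d theta4 \wedge theta4) v
        = ((Omega2 \wedge theta1 \+ Omega3 \wedge theta2) \wedge theta4) v,
      (ext_d theta1 \wedge theta1 \wedge theta2 \wedge theta4 \wedge Omega3) v
        = 0,
      (ext_d theta2 \wedge theta1 \wedge theta2 \wedge theta4 \wedge Omega2) v
        = 0,
      (ext_d theta1 \wedge theta1 \wedge theta3 \wedge theta4 \wedge Omega3) v
        = 0
    & (ext_d theta2 \wedge theta2 \wedge theta3 \wedge theta4 \wedge Omega2) v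
        = 0].

End lifted_forms.

(* The lifted forms live on a manifold M fibred over U, on which the (possibly
   restricted) group parameters are smooth functions; k = 0 and M = U is the
   case of a coframe on the jet space itself.  Identities between forms on M
   are read in each adapted chart. *)
Definition admits_lifted_forms (K : realType) (U : set 'rV[K]_6)
    (R T DyR DxT : 'rV[K]_6 -> K) : Prop :=
  exists (k : nat) (M : fibred_manifold U k) (g : coefficients K (total_space M)),
    [/\ smooth_coefficients g,
        forall m, ca g m * \det (cf g m) * \det (ch g m) != 0
      & forall (i : chart M) (v : 'rV[K]_(6 + k)), dom i v ->
          structure_equations R T DyR DxT
            (pull_coefficients (@param K U k M i) g) v].

(* Main.v *)
Require Import Defs.
From HB Require Import structures.
From mathcomp Require Import all_boot all_order all_algebra.
From mathcomp Require Import all_classical all_reals all_analysis.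
From mathcomp Require Import ring.
Import Order.TTheory GRing.Theory Num.Theory numFieldNormedType.Exports.
Local Open Scope classical_set_scope.
Local Open Scope ring_scope.

(** Everything is read off pointwise, by evaluating both sides of each structure
   equation on tangent vectors that are constant in a chart of the manifold on
   which the lifted forms live.  Two kinds of vectors occur, both with zero
   components along the fibre: horizontal ones X = x D_x + y D_y, killed by
   lambda and the nu_i, and vertical ones Y = p d/dp + q d/dq + s d/ds, killed by
   lambda, mu_1 and mu_2.

   Since d lambda = mu_1 /\ nu_1 + mu_2 /\ nu_2, the first equation gives
   f_13 = f_23 = 0 and shows that Omega_3 kills f_11 D_x + f_12 D_y, while Omega_2
   kills f_21 D_x + f_22 D_y ([cf_column]).  Let F = (F_1, F_2) be one of the rows
   (f_11, f_12), (f_21, f_22), let theta be the corresponding form and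
   X = F_1 D_x + F_2 D_y.

   - The equations whose factors include theta^1 and theta^2 say that
     d theta (X, d/ds) = 0, which is Q(F) = 0 for the quadratic form
     Q(F) = R_s F_1^2 + 2 F_1 F_2 + T_s F_2^2 ([null_rows]).
   - The equations whose factors include theta and theta^3 say that
     d theta (X, Y) = 0 for the vertical Y with nu_1 = - F_2 and nu_2 = F_1 that
     theta^3 kills.  The unknown b_i drops out, and the derivatives of the f_ij
     enter only as F_1 X(F_2) - F_2 X(F_1).

   Since F is a null vector, the gradient (2 (R_s F_1 + F_2), 2 (F_1 + T_s F_2)) of
   Q at F is proportional to (- F_2, F_1).  Differentiating Q(F) = 0 along X thus
   expresses F_1 X(F_2) - F_2 X(F_1) through X(R_s) and X(T_s), and the second
   condition becomes C(F) = 0 for a binary cubic form C whose coefficients are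
   functions on the jet space ([cubic_row]).  The two rows are linearly
   independent, so they are the two null directions of Q, and C vanishes at both:
   C is divisible by Q.  Equating the coefficients of C with those of a product of
   Q and a linear form and eliminating the latter leaves two relations
   ([cubic_vanishing]), which are J_1 = 0 and J_2 = 0. *)

(** * Contraction of alternating tensors *)

Section exterior_algebra.
Set Implicit Arguments.
Unset Strict Implicit.
Unset Printing Implicit Defensive.
Context (K : realType) (n : nat).
Local Notation alt := {ffun {set 'I_n} -> K}.
Implicit Types (w e : diff_form K n) (t : alt) (X Y : 'rV[K]_n) (i j k : 'I_n)
  (A S : {set 'I_n}).

Local Notation sg A i := (shuffle_sign K A [set i]%SET).

Lemma shuffle_sign1 A i :
  sg A i = (-1) ^+ #|[set j in A | (i < j)%N]%SET|.
Proof.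
rewrite /shuffle_sign; congr (_ ^+ _).
rewrite -(@card_imset _ _ (fun j => (j, i)) [set j in A | (i < j)%N]%SET); last first.
  by move=> a b [].
apply: eq_card => -[a b]; rewrite !inE /=; apply/idP/imsetP.
- by case/and3P=> aA /eqP -> ib; exists a; rewrite // inE aA.
- by case=> c; rewrite inE => /andP[cA ic] [-> ->]; rewrite cA eqxx.
Qed.

Lemma shuffle_sign_setU1 A i j : i \notin A ->
  sg (i |: A)%SET j = (-1) ^+ (j < i)%N * sg A j.
Proof.
move=> iA; rewrite !shuffle_sign1 -exprD; congr (_ ^+ _).
have [ji|ij] := ltnP j i.
- have iB : i \notin [set x in A | (j < x)%N]%SET by rewrite inE (negPf iA).
  rewrite -[true : nat]/(1%N) -[1%N]/(nat_of_bool true) -iB -finset.cardsU1.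
  apply: eq_card => x; rewrite !inE.
  by case: (eqVneq x i) => [->|_]; rewrite ?ji.
- rewrite add0n; apply: eq_card => x; rewrite !inE.
  by case: (eqVneq x i) => [->|_] //=; rewrite ltnNge ij (negPf iA).
Qed.

Lemma shuffle_sign1_sq A i : sg A i * sg A i = 1.
Proof. by rewrite shuffle_sign1 -expr2 sqrr_sign. Qed.

(** This identity makes the contraction an antiderivation. *)
Lemma shuffle_sign_exchange A i j : i \notin A -> j \notin A -> i != j ->
  sg (i |: A)%SET j * sg (j |: A)%SET i = - (sg A i * sg A j).
Proof.
move=> iA jA ij; rewrite !shuffle_sign_setU1 //.
rewrite [LHS](_ : _ =
  ((-1) ^+ (j < i)%N * (-1) ^+ (i < j)%N) * (sg A i * sg A j)); last by ring.
rewrite -exprD.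
suff -> : ((j < i)%N + (i < j)%N = 1)%N by rewrite expr1 mulN1r.
by case: ltngtP ij => // /val_inj ->; rewrite eqxx.
Qed.

(** Covectors are the alternating tensors of degree one. *)
Definition covector t := forall S, #|S| != 1%N -> t S = 0.

(** The value on the vector [X] of a covector [t]. *)
Definition pairing t X := \sum_i X 0 i * t [set i]%SET.

(** Contraction with [X] in the last argument: if [w] has degree [r + 1] then
   (contract X w)(Y_1, ..., Y_r) = w(Y_1, ..., Y_r, X).  Contracting on the right
   makes the sign in [contract_wedge] independent of the degree of [w]. *)
Definition contract X t : alt :=
  [ffun S : {set 'I_n} =>
     \sum_(i | i \notin S) sg S i * X 0 i * t (i |: S)%SET].

Lemma wedge_covector w e v S : covector (e v) ->
  (w \wedge e) v S = \sum_(k in S) sg (S :\ k)%SET k * w v (S :\ k)%SET * e v [set k]%SET.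
Proof.
move=> e1; rewrite ffunE.
(* Only the subsets A of S whose complement in S is a singleton contribute. *)
pose I := [set (S :\ k)%SET | k in S]%SET.
rewrite (bigID (fun A : {set 'I_n} => A \in I)) /= [X in _ + X]big1 ?addr0; last first.
  move=> A /andP[]; rewrite powersetE => AS AI.
  rewrite [X in _ * X]e1 ?mulr0 //; apply: contraNN AI => /cards1P[k Ek].
  have kSA : k \in (S :\: A)%SET by rewrite Ek inE.
  apply/imsetP; exists k; first by case/finset.setDP: kSA.
  by rewrite -Ek finset.setDDr finset.setDv finset.set0U; apply/esym/finset.setIidPr.
rewrite (eq_bigl (fun A => A \in I)); last first.
  move=> A; rewrite powersetE andb_idl // => /imsetP[k kS ->].
  exact: subD1set.
rewrite big_imset /=; last first.
  move=> k l kS lS /setP /(_ k); rewrite !inE eqxx kS /= andbT.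
  by move/esym/negbFE/eqP.
apply: eq_bigr => k kS.
suff -> : (S :\: (S :\ k) = [set k])%SET by [].
by rewrite finset.setDDr finset.setDv finset.set0U;
  apply/finset.setIidPr; rewrite finset.sub1set.
Qed.

Lemma contract_wedge w e v X : covector (e v) ->
  contract X ((w \wedge e) v) =
  pairing (e v) X *: w v - ((fun=> contract X (w v)) \wedge e) v.
Proof.
move=> e1; apply/ffunP => S.
have we u A : (u \wedge e) v A
    = \sum_(k in A) sg (A :\ k)%SET k * u v (A :\ k)%SET * e v [set k]%SET.
  exact: wedge_covector.
rewrite [LHS]ffunE [RHS]ffunE [X in _ = X + _]ffunE [X in _ = _ + X]ffunE we.
(* The terms i \notin S of the pairing are the diagonal terms k = i on the left;
   those with i \in S are the diagonal terms of the wedge on the right. *)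
rewrite -[_ *: _]/(_ * _) [pairing _ _](bigID (fun i => i \notin S)) /= mulrDl.
under eq_bigr => i iS.
  rewrite we finset.big_setU1 //= finset.setU1K // mulrDr.
  over.
rewrite big_split /= -addrA; congr (_ + _).
  rewrite mulr_suml; apply: eq_bigr => i iS.
  rewrite [LHS](_ : _ = (sg S i * sg S i) * (X 0 i * e v [set i]%SET * w v S)); last by ring.
  by rewrite shuffle_sign1_sq mul1r.
rewrite [X in _ = X * _ + _](eq_bigl (fun i => i \in S)); last first.
  by move=> i; rewrite negbK.
under [X in - X]eq_bigr => k kS.
  rewrite ffunE (bigD1 k) /=; last by rewrite !inE eqxx.
  rewrite finset.setD1K // (eq_bigl (fun i => i \notin S)); last first.
    by move=> i; rewrite !inE; case: eqVneq => [->|] /=; rewrite ?kS ?andbT.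
  rewrite mulrDr mulrDl.
  over.
rewrite big_split /= opprD addrA mulr_suml.
rewrite [X in X - _ - _](_ : _ = \sum_(k in S) X 0 k * e v [set k]%SET * w v S) //.
rewrite [X in _ - X - _](_ : _ = \sum_(k in S) X 0 k * e v [set k]%SET * w v S); last first.
  apply: eq_bigr => k kS.
  rewrite [LHS](_ : _ = (sg (S :\ k)%SET k * sg (S :\ k)%SET k) *
    (X 0 k * e v [set k]%SET * w v S)); last by ring.
  by rewrite shuffle_sign1_sq mul1r.
rewrite subrr add0r.
under eq_bigr => i iS do rewrite mulr_sumr.
rewrite exchange_big /= -sumrN; apply: eq_bigr => k kS.
rewrite mulr_sumr mulr_suml -sumrN; apply: eq_bigr => i iS.
have ik : i != k by apply: contraNneq iS => ->.
have kSk : k \notin (S :\ k)%SET by rewrite !inE eqxx.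
have iSk : i \notin (S :\ k)%SET by rewrite !inE negb_and iS orbT.
have -> : ((i |: S) :\ k = i |: (S :\ k))%SET.
  apply/setP => x; rewrite !inE; case: (eqVneq x i) => [->|] //=.
  by rewrite ik.
have := shuffle_sign_exchange kSk iSk; rewrite eq_sym ik => /(_ isT).
rewrite finset.setD1K // => E.
rewrite [LHS](_ : _ = (sg S i * sg (i |: S :\ k)%SET k) *
   (X 0 i * w v (i |: S :\ k)%SET * e v [set k]%SET)); last by ring.
by rewrite E; ring.
Qed.

(** [evaluate t [:: X_1; ...; X_r]] is t(X_r, ..., X_1) for [t] of degree [r]. *)
Fixpoint evaluate t (L : seq 'rV[K]_n) : K :=
  if L is X :: L' then evaluate (contract X t) L' else t finset.set0.

Lemma contractD X t1 t2 : contract X (t1 + t2) = contract X t1 + contract X t2.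
Proof.
apply/ffunP => S; rewrite !ffunE -big_split; apply: eq_bigr => i _.
by rewrite ffunE mulrDr.
Qed.

Lemma contractZ X a t : contract X (a *: t) = a *: contract X t.
Proof.
apply/ffunP => S; rewrite !ffunE /= scaler_sumr; apply: eq_bigr => i _.
by rewrite ffunE -[_ *: _]/(_ * _) -[_ *: _]/(_ * _); ring.
Qed.

Lemma evaluateD L t1 t2 : evaluate (t1 + t2) L = evaluate t1 L + evaluate t2 L.
Proof. by elim: L t1 t2 => [|X L IH] t1 t2 /=; rewrite ?ffunE // contractD IH. Qed.

Lemma evaluateZ L a t : evaluate (a *: t) L = a * evaluate t L.
Proof. by elim: L t => [|X L IH] t /=; rewrite ?ffunE // contractZ IH. Qed.

Lemma evaluate0 L : evaluate 0 L = 0.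
Proof. by rewrite -[X in evaluate X](scale0r 0) evaluateZ mul0r. Qed.

Lemma evaluateN L t : evaluate (- t) L = - evaluate t L.
Proof. by rewrite -scaleN1r evaluateZ mulN1r. Qed.

Lemma evaluate_sum L m (F : 'I_m -> alt) :
  evaluate (\sum_i F i) L = \sum_i evaluate (F i) L.
Proof.
apply: (big_morph (fun t => evaluate t L) _ (evaluate0 L)).
by move=> t1 t2; rewrite evaluateD.
Qed.

(** When the covector [e v] kills all the vectors but the last one, a single term
   of the expansion of the wedge product survives. *)
Lemma evaluate_wedge_rcons L X w e v : covector (e v) ->
  (forall Y, Y \in L -> pairing (e v) Y = 0) ->
  evaluate ((w \wedge e) v) (rcons L X) =
  (-1) ^+ size L * pairing (e v) X * evaluate (w v) L.
Proof.
move=> e1; elim: L w => [|Y L IH] w eL /=.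
  rewrite contract_wedge // !ffunE expr0 mul1r -[_ *: _]/(_ * _).
  rewrite -[RHS]addr0; congr (_ + _); apply/eqP; rewrite oppr_eq0; apply/eqP.
  rewrite big1 // => A; rewrite powersetE finset.subset0 => /eqP ->.
  by rewrite [X in _ * X]e1 ?mulr0 // finset.setD0 cards0.
rewrite contract_wedge // eL ?mem_head // scale0r add0r evaluateN IH; last first.
  by move=> Z ZL; rewrite eL // inE ZL orbT.
by rewrite exprS; ring.
Qed.

Lemma evaluate_wedge2 w e v X Y : covector (w v) -> covector (e v) ->
  evaluate ((w \wedge e) v) [:: X; Y] =
  pairing (e v) X * pairing (w v) Y - pairing (w v) X * pairing (e v) Y.
Proof.
have c1 t Z : covector t -> contract Z t finset.set0 = pairing t Z.
  move=> _; rewrite ffunE; apply: eq_big => [i|i _]; first by rewrite inE.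
  rewrite shuffle_sign1 finset.setU0 (_ : #|_| = 0%N) ?expr0 ?mul1r //.
  by apply: eq_card0 => x; rewrite !inE.
move=> w1 e1.
rewrite -[LHS]/(evaluate (contract X ((w \wedge e) v)) [:: Y]) contract_wedge //.
rewrite evaluateD evaluateZ evaluateN.
rewrite (@evaluate_wedge_rcons [::] Y (fun=> contract X (w v)) e) //= !c1 //; ring.
Qed.

End exterior_algebra.

(** * Exterior derivative of a one-form *)

Section exterior_derivative.
Set Implicit Arguments.
Unset Strict Implicit.
Unset Printing Implicit Defensive.
Context (K : realType) (n : nat).
Local Notation alt := {ffun {set 'I_n} -> K}.
Implicit Types (w e : diff_form K n) (t : alt) (v X Y : 'rV[K]_n) (i : 'I_n).

Lemma covectorD t1 t2 : covector t1 -> covector t2 -> covector (t1 + t2).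
Proof. by move=> h1 h2 S S1; rewrite ffunE h1 ?h2 ?addr0. Qed.

Lemma covectorZ a t : covector t -> covector (a *: t).
Proof. by move=> h S S1; rewrite ffunE h ?scaler0. Qed.

Lemma covectorN t : covector t -> covector (- t).
Proof. by rewrite -scaleN1r; exact: covectorZ. Qed.

Lemma covector_dcoord i v : covector (dcoord (K := K) i v).
Proof.
move=> S S1; rewrite ffunE; case: eqVneq => // SE.
by rewrite SE cards1 in S1.
Qed.

Lemma pairingD t1 t2 X : pairing (t1 + t2) X = pairing t1 X + pairing t2 X.
Proof.
by rewrite -big_split; apply: eq_bigr => i _; rewrite ffunE mulrDr.
Qed.

Lemma pairingZ a t X : pairing (a *: t) X = a * pairing t X.
Proof.
by rewrite mulr_sumr; apply: eq_bigr => i _; rewrite ffunE -[_ *: _]/(_ * _); ring.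
Qed.

Lemma pairingN t X : pairing (- t) X = - pairing t X.
Proof. by rewrite -scaleN1r pairingZ mulN1r. Qed.

Lemma pairing_dcoord i v X : pairing (dcoord i v) X = X 0 i.
Proof.
rewrite /pairing (bigD1 i) //= big1 ?addr0 => [|j ji].
  by rewrite ffunE eqxx mulr1.
by rewrite ffunE (inj_eq (@finset.set1_inj _)) (negPf ji) mulr0.
Qed.

Lemma derive_partials (F : 'rV[K]_n -> K) v X : differentiable F v ->
  'D_X F v = \sum_i X 0 i * partial i F v.
Proof.
move=> dF; rewrite deriveE // {1}(row_sum_delta X) linear_sum.
by apply: eq_bigr => i _; rewrite linearZ /= /partial deriveE.
Qed.

Lemma ext_d_near w e v : (\near v, w v = e v) -> ext_d w v = ext_d e v.
Proof.
move=> we; rewrite /ext_d; apply: eq_bigr => i _.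
rewrite /wedge; apply/ffunP => S; rewrite !ffunE; apply: eq_bigr => A _.
congr (_ * _); rewrite !ffunE; apply: near_eq_derive.
by apply: filterS we => u ->.
Qed.

(** With the order of arguments of [evaluate], this is the usual formula
   dw(Y, X) = Y(w(X)) - X(w(Y)) for constant vector fields [X] and [Y]. *)
Lemma evaluate_ext_d w v X Y : (forall u, covector (w u)) ->
  (forall j, differentiable (fun u => w u [set j]%SET) v) ->
  evaluate (ext_d w v) [:: X; Y] =
  'D_Y (fun u => pairing (w u) X) v - 'D_X (fun u => pairing (w u) Y) v.
Proof.
move=> w1 dw.
have dp Z : differentiable (fun u => pairing (w u) Z) v.
  rewrite (_ : (fun _ => _) = \sum_i (fun u => Z 0 i * w u [set i]%SET)); last first.
    by apply/funext => u; rewrite fct_sumE.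
  by apply: differentiable_sum => i; apply: differentiableZ.
have pw i Z : pairing [ffun S => partial i (fun u => w u S) v] Z =
    partial i (fun u => pairing (w u) Z) v.
  rewrite /partial (_ : (fun u => pairing _ _) =
    \sum_i (fun u => Z 0 i * w u [set i]%SET)); last first.
    by apply/funext => u; rewrite fct_sumE.
  rewrite derive_sum => [|j]; last exact/diff_derivable/differentiableZ.
  apply: eq_bigr => j _; rewrite ffunE.
  by rewrite -[RHS]/('D__ (Z 0 j \*: (fun u => w u [set j]%SET)) v) deriveZ //;
    exact/diff_derivable.
rewrite /ext_d evaluate_sum !derive_partials // -sumrB; apply: eq_bigr => i _.
rewrite evaluate_wedge2; last 2 first.
- exact: covector_dcoord.
- move=> S S1; rewrite ffunE /partial (_ : (fun _ => _) = cst 0) ?derive_cst //.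
  by apply/funext => u; rewrite w1.
by rewrite !pairing_dcoord !pw mulrC.
Qed.

End exterior_derivative.

(** * The coframe of the jet space *)

Section jet_coframe.
Set Implicit Arguments.
Unset Strict Implicit.
Unset Printing Implicit Defensive.
Context (K : realType) (k : nat).
Implicit Types (R T DyR DxT F : 'rV[K]_6 -> K) (v X Y Z W : 'rV[K]_(6 + k))
  (b f : 'rV[K]_(6 + k) -> K).

Lemma lsubmx_coord X j : lsubmx X 0 j = X 0 (lshift k j).
Proof. by rewrite mxE. Qed.

Lemma pairing_lambda v X : pairing (lambda v) X =
  lsubmx X 0 jz - lsubmx v 0 jp * lsubmx X 0 jx - lsubmx v 0 jq * lsubmx X 0 jy.
Proof.
by rewrite !(pairingD, pairingN, pairingZ) !pairing_dcoord !lsubmx_coord.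
Qed.

Lemma pairing_mu1 v X : pairing (mu1 v) X = lsubmx X 0 jx.
Proof. by rewrite pairing_dcoord !lsubmx_coord. Qed.

Lemma pairing_mu2 v X : pairing (mu2 v) X = lsubmx X 0 jy.
Proof. by rewrite pairing_dcoord !lsubmx_coord. Qed.

Lemma pairing_nu1 R v X : pairing (nu1 R v) X =
  lsubmx X 0 jp - R (lsubmx v) * lsubmx X 0 jx - lsubmx v 0 js * lsubmx X 0 jy.
Proof.
by rewrite !(pairingD, pairingN, pairingZ) !pairing_dcoord !lsubmx_coord.
Qed.

Lemma pairing_nu2 T v X : pairing (nu2 T v) X =
  lsubmx X 0 jq - lsubmx v 0 js * lsubmx X 0 jx - T (lsubmx v) * lsubmx X 0 jy.
Proof.
by rewrite !(pairingD, pairingN, pairingZ) !pairing_dcoord !lsubmx_coord.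
Qed.

Lemma pairing_nu3 DyR DxT v X : pairing (nu3 DyR DxT v) X =
  lsubmx X 0 js - DyR (lsubmx v) * lsubmx X 0 jx
  - DxT (lsubmx v) * lsubmx X 0 jy.
Proof.
by rewrite !(pairingD, pairingN, pairingZ) !pairing_dcoord !lsubmx_coord.
Qed.

Lemma covector_lambda v : covector (lambda v).
Proof.
by do !(apply: covectorD || apply: covectorN || apply: covectorZ);
   apply: covector_dcoord.
Qed.

Lemma covector_nu1 R v : covector (nu1 R v).
Proof.
by do !(apply: covectorD || apply: covectorN || apply: covectorZ);
   apply: covector_dcoord.
Qed.

Lemma covector_nu2 T v : covector (nu2 T v).
Proof.
by do !(apply: covectorD || apply: covectorN || apply: covectorZ);
   apply: covector_dcoord.
Qed.

Lemma covector_nu3 DyR DxT v : covector (nu3 DyR DxT v).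
Proof.
by do !(apply: covectorD || apply: covectorN || apply: covectorZ);
   apply: covector_dcoord.
Qed.

Lemma covector_theta_row R T DyR DxT g i v :
  covector (theta_row R T DyR DxT g i v).
Proof.
apply: covectorD; last exact/covectorZ/covector_nu3.
apply: covectorD; last exact/covectorZ/covector_nu2.
apply: covectorD; last exact/covectorZ/covector_nu1.
exact/covectorZ/covector_lambda.
Qed.

Lemma covector_Omega_row (g : coefficients K 'rV[K]_(6 + k)) i v :
  covector (Omega_row g i v).
Proof.
apply: covectorD; last exact/covectorZ/covector_dcoord.
apply: covectorD; last exact/covectorZ/covector_dcoord.
exact/covectorZ/covector_lambda.
Qed.

Lemma differentiable_jet F v : differentiable F (lsubmx v) ->
  differentiable (fun u : 'rV[K]_(6 + k) => F (lsubmx u)) v.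
Proof. by apply: differentiable_comp; exact: differentiable_lsubmx. Qed.

Lemma is_derive_jet F v Z : differentiable F (lsubmx v) ->
  is_derive v Z (fun u : 'rV[K]_(6 + k) => F (lsubmx u))
    ('D_(lsubmx Z) F (lsubmx v)).
Proof.
move=> dF; apply: DeriveDef; first exact/diff_derivable/differentiable_jet.
rewrite deriveE; last exact: differentiable_jet.
rewrite (diff_comp (differentiable_lsubmx v) dF) /= deriveE //.
by rewrite diff_lin //; exact: continuous_lsubmx.
Qed.

Lemma derive_coord (P Q : 'rV[K]_6) j : 'D_Q (fun u : 'rV[K]_6 => u 0 j) P = Q 0 j.
Proof.
have := @derive_mx K _ _ _ (fun u : 'rV[K]_6 => u) P Q (@derivable_id _ _ _ _).
by move/matrixP => /(_ 0 j); rewrite derive_id mxE.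
Qed.

Lemma is_derive_jet_coord v Z j :
  is_derive v Z (fun u : 'rV[K]_(6 + k) => lsubmx u 0 j) (lsubmx Z 0 j).
Proof.
apply: (@is_derive_eq _ _ _ _ _ _ _ ('D_(lsubmx Z) (fun u : 'rV[K]_6 => u 0 j) (lsubmx v))).
  by apply: is_derive_jet; exact: differentiable_coord.
exact: derive_coord.
Qed.

Lemma differentiable_jet_coord v j :
  differentiable (fun u : 'rV[K]_(6 + k) => lsubmx u 0 j) v.
Proof.
exact/(differentiable_jet (F := fun P : 'rV[K]_6 => P 0 j))/differentiable_coord.
Qed.

(** The one-form b lambda + f1 nu_1 + f2 nu_2.  The forms theta^4, theta^1 and
   theta^2 are of this kind once f_13 = f_23 = 0; as nu_3 does not occur, no
   regularity of [DyR] and [DxT] is needed to differentiate them. *)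
Definition contact_form R T (b f1 f2 : 'rV[K]_(6 + k) -> K) : diff_form K (6 + k) :=
  fun u => b u *: lambda u + f1 u *: nu1 R u + f2 u *: nu2 T u.

Lemma covector_contact_form R T b f1 f2 v : covector (contact_form R T b f1 f2 v).
Proof.
apply: covectorD; last exact/covectorZ/covector_nu2.
apply: covectorD; last exact/covectorZ/covector_nu1.
exact/covectorZ/covector_lambda.
Qed.

Lemma pairing_contact_form R T b f1 f2 v X :
  pairing (contact_form R T b f1 f2 v) X =
  b v * pairing (lambda v) X + f1 v * pairing (nu1 R v) X
  + f2 v * pairing (nu2 T v) X.
Proof. by rewrite 2!pairingD 3!pairingZ. Qed.

Section derivative.
Variables (R T : 'rV[K]_6 -> K) (b f1 f2 : 'rV[K]_(6 + k) -> K) (v : 'rV[K]_(6 + k)).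
Hypotheses (dR : differentiable R (lsubmx v)) (dT : differentiable T (lsubmx v)).
Hypotheses (db : differentiable b v) (df1 : differentiable f1 v)
  (df2 : differentiable f2 v).

Let pairingE W : (fun u => pairing (contact_form R T b f1 f2 u) W) =
  b * (cst (lsubmx W 0 jz) - lsubmx W 0 jx *: (fun u => lsubmx u 0 jp)
       - lsubmx W 0 jy *: (fun u => lsubmx u 0 jq))
  + f1 * (cst (lsubmx W 0 jp) - lsubmx W 0 jx *: (fun u => R (lsubmx u))
       - lsubmx W 0 jy *: (fun u => lsubmx u 0 js))
  + f2 * (cst (lsubmx W 0 jq) - lsubmx W 0 jx *: (fun u => lsubmx u 0 js)
       - lsubmx W 0 jy *: (fun u => T (lsubmx u))) :> ('rV[K]_(6 + k) -> K).
Proof.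
apply/funext => u; rewrite pairing_contact_form pairing_lambda pairing_nu1 pairing_nu2.
rewrite -![(_ + _) u]/(_ u + _ u) -![(_ * _) u]/(_ u * _ u).
rewrite -![(_ + _) u]/(_ u + _ u) -![(- _) u]/(- (_ u)) -![(_ *: _) u]/(_ * _ u) /=.
ring.
Qed.

Lemma differentiable_contact_form W :
  differentiable (fun u => pairing (contact_form R T b f1 f2 u) W) v.
Proof.
have jc j := differentiable_jet_coord v j.
have jR := differentiable_jet dR.
have jT := differentiable_jet dT.
have dl (f g : 'rV[K]_(6 + k) -> K) c1 c2 c3 : differentiable f v ->
    differentiable g v -> differentiable (cst c1 - c2 *: f - c3 *: g) v.
  move=> df dg; apply: differentiableB; last exact: differentiableZ.
  by apply: differentiableB; last exact: differentiableZ.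
by rewrite pairingE; apply: differentiableD; first apply: differentiableD;
  apply: differentiableM => //; apply: dl.
Qed.

Lemma derive_contact_form Z W :
  'D_Z (fun u => pairing (contact_form R T b f1 f2 u) W) v =
  'D_Z b v * pairing (lambda v) W + 'D_Z f1 v * pairing (nu1 R v) W
  + 'D_Z f2 v * pairing (nu2 T v) W
  - b v * (lsubmx Z 0 jp * lsubmx W 0 jx + lsubmx Z 0 jq * lsubmx W 0 jy)
  - f1 v * ('D_(lsubmx Z) R (lsubmx v) * lsubmx W 0 jx
            + lsubmx Z 0 js * lsubmx W 0 jy)
  - f2 v * (lsubmx Z 0 js * lsubmx W 0 jx
            + 'D_(lsubmx Z) T (lsubmx v) * lsubmx W 0 jy).
Proof.
have jc j := is_derive_jet_coord v Z j.
have jR := is_derive_jet Z dR.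
have jT := is_derive_jet Z dT.
have [ib if1 if2] : [/\ is_derive v Z b ('D_Z b v),
    is_derive v Z f1 ('D_Z f1 v) & is_derive v Z f2 ('D_Z f2 v)].
  by split; exact/derivableP/diff_derivable.
rewrite pairingE; apply: derive_val; apply: is_derive_eq.
rewrite pairing_lambda pairing_nu1 pairing_nu2.

have sE (c d : K) : c *: d = c * d by [].
have fE (c1 c2 c3 : K) (f g : 'rV[K]_(6 + k) -> K) :
  (cst c1 - c2 *: f - c3 *: g) v = c1 - c2 * f v - c3 * g v by [].
by rewrite !fE !sE; ring.
Qed.
End derivative.
End jet_coframe.

(** * Tangent vectors of the jet space *)

Section jet_vectors.
Set Implicit Arguments.
Unset Strict Implicit.
Unset Printing Implicit Defensive.
Context (K : realType) (k : nat).
Implicit Types (R T DyR DxT F : 'rV[K]_6 -> K) (P : 'rV[K]_6)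
  (v X Y Z W : 'rV[K]_(6 + k)) (x y z p q s : K).

(** The vector with the given components along the jet coordinates and zero
   components along the fibre. *)
Definition tangent x y z p q s : 'rV[K]_(6 + k) :=
  row_mx (\row_(i < 6) [:: x; y; z; p; q; s]`_i) 0.

Lemma tangentE x y z p q s (V := lsubmx (tangent x y z p q s)) :
  (V 0 jx = x) * (V 0 jy = y) * (V 0 jz = z) *
  (V 0 jp = p) * (V 0 jq = q) * (V 0 js = s).
Proof. by rewrite /V row_mxKl !mxE. Qed.

(** The vector x D_x + y D_y at a point over [P]. *)
Definition total_direction R T DyR DxT P x y : 'rV[K]_(6 + k) :=
  tangent x y (P 0 jp * x + P 0 jq * y) (R P * x + P 0 js * y)
    (P 0 js * x + T P * y) (DyR P * x + DxT P * y).

(** The vector p d/dp + q d/dq + s d/ds. *)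
Definition vertical p q s := tangent 0 0 0 p q s.

Lemma derive_tangent F P x y z p q s : differentiable F P ->
  'D_(lsubmx (tangent x y z p q s)) F P =
  x * partial jx F P + y * partial jy F P + z * partial jz F P
  + p * partial jp F P + q * partial jq F P + s * partial js F P.
Proof.
move=> dF; rewrite derive_partials // !big_ord_recl big_ord0.
rewrite (_ : ord0 = jx) ?(_ : lift ord0 ord0 = jy); try exact: val_inj.
have -> : lift jx ord0 = jy by exact: val_inj.
have -> : lift jx (lift ord0 ord0) = jz by exact: val_inj.
have -> : lift jx (lift ord0 (lift ord0 ord0)) = jp by exact: val_inj.
have -> : lift jx (lift ord0 (lift ord0 (lift ord0 ord0))) = jq by exact: val_inj.
have -> : lift jx (lift ord0 (lift ord0 (lift ord0 (lift ord0 ord0)))) = js.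
  exact: val_inj.
rewrite !tangentE.
move: (partial jx F P) (partial jy F P) (partial jz F P) (partial jp F P)
  (partial jq F P) (partial js F P).
by move=> *; ring.
Qed.

Lemma derive_vertical F P p q s : differentiable F P ->
  'D_(lsubmx (vertical p q s)) F P =
  p * partial jp F P + q * partial jq F P + s * partial js F P.
Proof. by move=> dF; rewrite derive_tangent // !mul0r !add0r. Qed.

Lemma derive_total_direction R T DyR DxT F P x y : differentiable F P ->
  'D_(lsubmx (total_direction R T DyR DxT P x y)) F P =
  x * Dx R DyR F P + y * Dy T DxT F P.
Proof.
move=> dF; rewrite derive_tangent // /Dx /Dy.
move: (partial jx F P) (partial jy F P) (partial jz F P) (partial jp F P)
  (partial jq F P) (partial js F P).
by move=> *; ring.
Qed.

Section pairings.
Variables (R T DyR DxT : 'rV[K]_6 -> K) (v : 'rV[K]_(6 + k)).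
Variable (g : coefficients K 'rV[K]_(6 + k)).
Local Notation hor := (total_direction R T DyR DxT (lsubmx v)).

Lemma lambda_hor x y : pairing (lambda v) (hor x y) = 0.
Proof. by rewrite pairing_lambda !tangentE; ring. Qed.

Lemma nu1_hor x y : pairing (nu1 R v) (hor x y) = 0.
Proof. by rewrite pairing_nu1 !tangentE; ring. Qed.

Lemma nu2_hor x y : pairing (nu2 T v) (hor x y) = 0.
Proof. by rewrite pairing_nu2 !tangentE; ring. Qed.

Lemma theta_row_hor i x y : pairing (theta_row R T DyR DxT g i v) (hor x y) = 0.
Proof.
rewrite /theta_row 3!pairingD 4!pairingZ lambda_hor nu1_hor nu2_hor pairing_nu3.
by rewrite !tangentE; ring.
Qed.

Lemma theta_row_vertical i p q s :
  pairing (theta_row R T DyR DxT g i v) (vertical p q s) =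
  cf g v i (@Ordinal 3 0 isT) * p + cf g v i (@Ordinal 3 1 isT) * q
  + cf g v i (@Ordinal 3 2 isT) * s.
Proof.
rewrite /theta_row 3!pairingD 4!pairingZ pairing_lambda pairing_nu1 pairing_nu2.
by rewrite pairing_nu3 !tangentE; ring.
Qed.

Lemma theta4_pairing X : pairing (theta4 g v) X = ca g v * pairing (lambda v) X.
Proof. exact: pairingZ. Qed.

Lemma lambda_vertical p q s : pairing (lambda v) (vertical p q s) = 0.
Proof. by rewrite pairing_lambda !tangentE; ring. Qed.

Lemma Omega_row_pairing i X : pairing (Omega_row g i v) X =
  cc g v i 0 * pairing (lambda v) X + ch g v i (@Ordinal 2 0 isT) * lsubmx X 0 jx
  + ch g v i (@Ordinal 2 1 isT) * lsubmx X 0 jy.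
Proof. by rewrite /Omega_row 2!pairingD 3!pairingZ pairing_mu1 pairing_mu2. Qed.

(** The coefficient [b] enters only through d lambda: it contributes p x + q y. *)
Lemma evaluate_ext_d_contact b f1 f2 x y p q s :
  differentiable R (lsubmx v) -> differentiable T (lsubmx v) ->
  differentiable b v -> differentiable f1 v -> differentiable f2 v ->
  let d F := p * partial jp F (lsubmx v) + q * partial jq F (lsubmx v)
              + s * partial js F (lsubmx v) in
  evaluate (ext_d (contact_form R T b f1 f2) v) [:: hor x y; vertical p q s] =
  - (b v * (p * x + q * y) + f1 v * (d R * x + s * y) + f2 v * (s * x + d T * y)
     + 'D_(hor x y) f1 v * p + 'D_(hor x y) f2 v * q).
Proof.
move=> dR dT db df1 df2 d.
rewrite evaluate_ext_d; last 2 first.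
- by move=> u; exact: covector_contact_form.
- move=> j; rewrite (_ : (fun _ => _) =
    fun u => pairing (contact_form R T b f1 f2 u) (delta_mx 0 j)).
    exact: differentiable_contact_form.
  apply/funext => u; rewrite /pairing (bigD1 j) //= big1 ?addr0.
    by rewrite mxE !eqxx mul1r.
  by move=> i ij; rewrite mxE (negPf ij) andbF mul0r.
rewrite !derive_contact_form // lambda_hor nu1_hor nu2_hor lambda_vertical.
rewrite pairing_nu1 pairing_nu2 !derive_vertical // /d.
move: (partial jp R _) (partial jq R _) (partial js R _) (partial jp T _)
  (partial jq T _) (partial js T _) ('D_(hor x y) f1 v) ('D_(hor x y) f2 v)
  ('D_(hor x y) b v) ('D_(vertical p q s) f1 v) ('D_(vertical p q s) f2 v)
  ('D_(vertical p q s) b v) ('D_(lsubmx (hor x y)) R (lsubmx v))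
  ('D_(lsubmx (hor x y)) T (lsubmx v)) => *.
by rewrite !tangentE; ring.
Qed.
End pairings.
End jet_vectors.

(** * Small determinants and binary forms *)

Section determinants.
Variable K : comNzRingType.

Lemma det_mx2 (A : 'M[K]_2) (i0 := @Ordinal 2 0 isT) (i1 := @Ordinal 2 1 isT) :
  \det A = A i0 i0 * A i1 i1 - A i0 i1 * A i1 i0.
Proof.
have [E0 E1] : (ord0 : 'I_2) = i0 /\ lift (ord0 : 'I_2) ord0 = i1.
  by split; apply: val_inj.
rewrite (expand_det_row _ ord0) !big_ord_recl big_ord0 /cofactor !det_mx11 !mxE.
have E3 : lift i1 (ord0 : 'I_1) = i0 by exact: val_inj.
by rewrite !E1 !E0 !E3 /= expr0 expr1; ring.
Qed.

Lemma det_mx3_col (A : 'M[K]_3) (i0 := @Ordinal 3 0 isT) (i1 := @Ordinal 3 1 isT)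
    (i2 := @Ordinal 3 2 isT) : A i0 i2 = 0 -> A i1 i2 = 0 ->
  \det A = (A i0 i0 * A i1 i1 - A i0 i1 * A i1 i0) * A i2 i2.
Proof.
move=> A0 A1; rewrite (expand_det_col _ i2) !big_ord_recl big_ord0.
rewrite (_ : ord0 = i0) ?(_ : lift ord0 ord0 = i1)
  ?(_ : lift ord0 (lift ord0 ord0) = i2); try exact: val_inj.
have -> : lift i0 ord0 = i1 by exact: val_inj.
have -> : lift i0 (lift ord0 ord0) = i2 by exact: val_inj.
rewrite A0 A1 !mul0r !add0r addr0 /cofactor det_mx2 !mxE.
have -> : lift i2 (@Ordinal 2 0 isT) = i0 by exact: val_inj.
have -> : lift i2 (@Ordinal 2 1 isT) = i1 by exact: val_inj.
by rewrite -signr_odd /= expr0; ring.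
Qed.
End determinants.

Section binary_forms.
Set Implicit Arguments.
Unset Strict Implicit.

(** Two independent null vectors determine the quadratic form
   r x^2 + 2 x y + t y^2, normalised by its middle coefficient. *)
Lemma null_directions (K : numFieldType) (r t f1 f2 g1 g2 : K) :
  f1 * g2 - f2 * g1 != 0 ->
  r * f1 ^+ 2 + 2 * f1 * f2 + t * f2 ^+ 2 = 0 ->
  r * g1 ^+ 2 + 2 * g1 * g2 + t * g2 ^+ 2 = 0 ->
  [/\ f1 * g2 + f2 * g1 != 0,
      r = - 2 * f2 * g2 / (f1 * g2 + f2 * g1)
    & t = - 2 * f1 * g1 / (f1 * g2 + f2 * g1)].
Proof.
set D := f1 * g2 - _; set S := f1 * g2 + _ => D0 Qf Qg.
have rS : r * S = - 2 * f2 * g2.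
  apply: (mulfI D0); apply/eqP; rewrite -subr_eq0; apply/eqP.
  transitivity (g2 ^+ 2 * (r * f1 ^+ 2 + 2 * f1 * f2 + t * f2 ^+ 2)
                - f2 ^+ 2 * (r * g1 ^+ 2 + 2 * g1 * g2 + t * g2 ^+ 2)).
    by rewrite /D /S; ring.
  by rewrite Qf Qg !mulr0 subr0.
have tS : t * S = - 2 * f1 * g1.
  apply: (mulfI D0); apply/eqP; rewrite -subr_eq0; apply/eqP.
  transitivity (f1 ^+ 2 * (r * g1 ^+ 2 + 2 * g1 * g2 + t * g2 ^+ 2)
                - g1 ^+ 2 * (r * f1 ^+ 2 + 2 * f1 * f2 + t * f2 ^+ 2)).
    by rewrite /D /S; ring.
  by rewrite Qf Qg !mulr0 subr0.
have S0 : S != 0.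
  apply/eqP => S0; move/eqP: D0; apply; apply/eqP; rewrite -sqrf_eq0; apply/eqP.
  transitivity (S ^+ 2 - (- 2 * f2 * g2) * (- 2 * f1 * g1)).
    by rewrite /D /S; ring.
  by rewrite -rS -tS S0 !(mulr0, mul0r) subr0 expr0n.
by rewrite -rS -tS !mulfK.
Qed.

(** The binary cubic form [P] vanishes on the null directions of
   r x^2 + 2 x y + t y^2, hence is its product with some u x + w y; the two
   relations follow from c0 = r u, c1 = r w + 2 u, c2 = t u + 2 w, c3 = t w by
   eliminating u and w. *)
Lemma cubic_vanishing (K : numFieldType) (r t c0 c1 c2 c3 f1 f2 g1 g2 : K)
    (P := fun x y => c0 * x ^+ 3 + c1 * x ^+ 2 * y + c2 * x * y ^+ 2 + c3 * y ^+ 3) :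
  f1 * g2 - f2 * g1 != 0 ->
  r * f1 ^+ 2 + 2 * f1 * f2 + t * f2 ^+ 2 = 0 ->
  r * g1 ^+ 2 + 2 * g1 * g2 + t * g2 ^+ 2 = 0 ->
  P f1 f2 = 0 -> P g1 g2 = 0 ->
  (4 - r * t) * c0 = r * (2 * c1 - r * c2) /\
  (4 - r * t) * c3 = t * (2 * c2 - t * c1).
Proof.
move=> D0 Qf Qg Pf Pg; have [S0 -> ->] := null_directions D0 Qf Qg.
move: D0 S0; set D := f1 * g2 - _; set S := f1 * g2 + _ => D0 S0.
(* The combinations of P(f) and P(g) free of c3, respectively of c0. *)
split; apply: (mulfI D0); apply/eqP; rewrite -subr_eq0; apply/eqP.
- transitivity (4 / S ^+ 2 * (g2 ^+ 3 * P f1 f2 - f2 ^+ 3 * P g1 g2)).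
    by rewrite /D /P; move: S0; rewrite /S => S0; field.
  by rewrite Pf Pg !mulr0 subr0 mulr0.
- transitivity (4 / S ^+ 2 * (f1 ^+ 3 * P g1 g2 - g1 ^+ 3 * P f1 f2)).
    by rewrite /D /P; move: S0; rewrite /S => S0; field.
  by rewrite Pf Pg !mulr0 subr0 mulr0.
Qed.

(** Elimination of the derivatives [df1], [df2] of a null vector (f1, f2): the
   hypotheses are the null condition, its derivative along f1 D_x + f2 D_y, and
   the vanishing of d theta; [rx], ..., [ty] stand for the total derivatives of
   [r] and [t]. *)
Lemma cubic_of_null_row (K : fieldType)
    (r t Rp Rq Tp Tq rx ry tx ty s f1 f2 df1 df2 : K) :
  (f1 != 0) || (f2 != 0) ->
  r * f1 ^+ 2 + 2 * f1 * f2 + t * f2 ^+ 2 = 0 ->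
  2 * (r * f1 + f2) * df1 + 2 * (f1 + t * f2) * df2
    + f1 ^+ 2 * (f1 * rx + f2 * ry) + f2 ^+ 2 * (f1 * tx + f2 * ty) = 0 ->
  f1 * ((- f2 * Rp + f1 * Rq + s * r) * f1 + s * f2)
    + f2 * (s * f1 + (- f2 * Tp + f1 * Tq + s * t) * f2)
    - df1 * f2 + df2 * f1 = 0 ->
  (2 * Rq + 2 * Rp * r - rx) * f1 ^+ 3
  + (2 * Rq * t + 2 * Rp - ry) * f1 ^+ 2 * f2
  + (2 * Tq + 2 * Tp * r - tx) * f1 * f2 ^+ 2
  + (2 * Tq * t + 2 * Tp - ty) * f2 ^+ 3 = 0.
Proof.
move=> f0 Q dQ E.
(* The gradient of the quadratic form at the null vector (f1, f2) is 2c(- f2, f1). *)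
have [c uE wE] : exists2 c, r * f1 + f2 = - c * f2 & f1 + t * f2 = c * f1.
  have Q' : (r * f1 + f2) * f1 = - ((f1 + t * f2) * f2).
    by apply/eqP; rewrite -subr_eq0; apply/eqP; rewrite -[RHS]Q; ring.
  have [f10|f10] := eqVneq f1 0.
    rewrite f10 eqxx /= in f0.
    exists (- (r * f1 + f2) / f2); first by field.
    apply: (mulIf f0); apply: oppr_inj; rewrite -Q'; field.
    exact: f0.
  exists ((f1 + t * f2) / f1); last by field.
  by apply: (mulIf f10); rewrite Q'; field.
set P := (X in X = 0).
set EE := (X in X = 0) in E; set QQ := (X in X = 0) in Q.
set DQ := (X in X = 0) in dQ.
have -> : P = 2 * c * EE - DQ - 2 * c * s * QQ
  + (r * f1 + f2 - - c * f2) * (2 * f1 ^+ 2 * Rp + 2 * f2 ^+ 2 * Tp + 2 * df1)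
  + (f1 + t * f2 - c * f1) * (2 * f1 ^+ 2 * Rq + 2 * f2 ^+ 2 * Tq + 2 * df2).
  by rewrite /P /EE /DQ /QQ; ring.
by rewrite E Q dQ uE wE; ring.
Qed.

(** The identity says that Omega_2 /\ theta^1 + Omega_3 /\ theta^2 equals
   a (mu_1 /\ nu_1 + mu_2 /\ nu_2) modulo lambda. *)
Lemma block_structure (K : fieldType) (a h00 h01 h10 h11 f00 f01 f02 f10 f11 f12 : K) :
  h00 * h11 - h01 * h10 != 0 ->
  (forall x y p q s, a * (p * x + q * y) =
     (h10 * x + h11 * y) * (f00 * p + f01 * q + f02 * s)
     + (h00 * x + h01 * y) * (f10 * p + f11 * q + f12 * s)) ->
  [/\ f02 = 0, f12 = 0 & f00 * f11 - f01 * f10 != 0 ->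
      h00 * f00 + h01 * f01 = 0 /\ h10 * f10 + h11 * f11 = 0].
Proof.
move=> h0 E.
have sim := (mulr0, mulr1, mul0r, mul1r, addr0, add0r).
have := E 1 0 0 0 1; have := E 0 1 0 0 1; have := E 1 0 1 0 0.
have := E 0 1 1 0 0; have := E 1 0 0 1 0; have := E 0 1 0 1 0.
rewrite !sim => q2 q1 p2 p1 s2 s1; split.
- apply: (mulfI h0); rewrite mulr0.
  transitivity (h00 * (h11 * f02 + h01 * f12) - h01 * (h10 * f02 + h00 * f12)).
    by ring.
  by rewrite -s1 -s2; ring.
- apply: (mulfI h0); rewrite mulr0.
  transitivity (h11 * (h10 * f02 + h00 * f12) - h10 * (h11 * f02 + h01 * f12)).
    by ring.
  by rewrite -s1 -s2; ring.
move=> d0; split; apply: (mulfI d0); rewrite mulr0.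
- transitivity (f00 * (f00 * (h10 * f01 + h00 * f11) - f01 * (h10 * f00 + h00 * f10))
    + f01 * (f00 * (h11 * f01 + h01 * f11) - f01 * (h11 * f00 + h01 * f10))).
    by ring.
  by rewrite -p1 -p2 -q1 -q2; ring.
- transitivity (f10 * (f11 * (h10 * f00 + h00 * f10) - f10 * (h10 * f01 + h00 * f11))
    + f11 * (f11 * (h11 * f00 + h01 * f10) - f10 * (h11 * f01 + h01 * f11))).
    by ring.
  by rewrite -p1 -p2 -q1 -q2; ring.
Qed.

End binary_forms.

(** * The structure equations in a chart *)

Section wedge4.
Set Implicit Arguments.
Unset Strict Implicit.
Unset Printing Implicit Defensive.

(** If w /\ e1 /\ e2 /\ e3 /\ e4 = 0, then w(X, Y) = 0 for vectors X and Y killed by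
   the e_i; the independence of the e_i is witnessed by the vectors E_i, on which
   they are triangular. *)
Lemma evaluate_mod4 (K : realType) (n : nat) (w e1 e2 e3 e4 : diff_form K n)
    (v X Y E1 E2 E3 E4 : 'rV[K]_n) :
  covector (e1 v) -> covector (e2 v) -> covector (e3 v) -> covector (e4 v) ->
  (w \wedge e1 \wedge e2 \wedge e3 \wedge e4) v = 0 ->
  {in [:: X; Y], forall Z, pairing (e1 v) Z = 0} ->
  {in [:: X; Y; E1], forall Z, pairing (e2 v) Z = 0} ->
  {in [:: X; Y; E1; E2], forall Z, pairing (e3 v) Z = 0} ->
  {in [:: X; Y; E1; E2; E3], forall Z, pairing (e4 v) Z = 0} ->
  pairing (e1 v) E1 != 0 -> pairing (e2 v) E2 != 0 ->
  pairing (e3 v) E3 != 0 -> pairing (e4 v) E4 != 0 ->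
  evaluate (w v) [:: X; Y] = 0.
Proof.
move=> c1 c2 c3 c4 w0 n1 n2 n3 n4 E10 E20 E30 E40.
have := congr1 (fun t => evaluate t [:: X; Y; E1; E2; E3; E4]) w0.
rewrite evaluate0 (@evaluate_wedge_rcons _ _ [:: X; Y; E1; E2; E3]) //.
rewrite (@evaluate_wedge_rcons _ _ [:: X; Y; E1; E2]) //.
rewrite (@evaluate_wedge_rcons _ _ [:: X; Y; E1]) //.
rewrite (@evaluate_wedge_rcons _ _ [:: X; Y]) //.
have sign0 m : (-1) ^+ m != 0 :> K by rewrite signr_eq0.
have cancel m (c d : K) : c != 0 -> (-1) ^+ m * c * d = 0 -> d = 0.
  by move=> c0 /eqP; rewrite mulf_eq0 (negPf (mulf_neq0 (sign0 m) c0)) => /eqP.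
by do 4!move/cancel => /(_ ltac:(assumption)).
Qed.
End wedge4.

Section chart_argument.
Set Implicit Arguments.
Unset Strict Implicit.
Unset Printing Implicit Defensive.
Context (K : realType) (k : nat).
Variables (R T DyR DxT : 'rV[K]_6 -> K) (g : coefficients K 'rV[K]_(6 + k)).
Local Notation i0 := (@Ordinal 3 0 isT).
Local Notation i1 := (@Ordinal 3 1 isT).
Local Notation i2 := (@Ordinal 3 2 isT).
Local Notation j0 := (@Ordinal 2 0 isT).
Local Notation j1 := (@Ordinal 2 1 isT).
Local Notation hor v := (total_direction k R T DyR DxT (lsubmx v)).
Local Notation theta := (theta_row R T DyR DxT g).

(** Only the witnesses (p1, q1, s1) and (p2, q2, s2) for the two factors theta have
   to be supplied: those for theta^4 and Omega do not depend on them. *)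
Lemma evaluate_mod_coframe (i i' : 'I_3) (j : 'I_2) (w : diff_form K (6 + k))
    v x y p q s p1 q1 s1 p2 q2 s2 :
  (w \wedge theta i \wedge theta i' \wedge theta4 g \wedge Omega_row g j) v = 0 ->
  ca g v != 0 -> (ch g v j j0 != 0) || (ch g v j j1 != 0) ->
  ch g v j j0 * x + ch g v j j1 * y = 0 ->
  pairing (theta i v) (vertical k p q s) = 0 ->
  pairing (theta i' v) (vertical k p q s) = 0 ->
  pairing (theta i' v) (vertical k p1 q1 s1) = 0 ->
  pairing (theta i v) (vertical k p1 q1 s1) != 0 ->
  pairing (theta i' v) (vertical k p2 q2 s2) != 0 ->
  evaluate (w v) [:: hor v x y; vertical k p q s] = 0.
Proof.
move=> w0 a0 h0 hxy Yi Yi' E1i' E1i E2i'.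
(* E4 = h_1 D_x + h_2 D_y for the row (h_1, h_2) of Omega, and E3 has the x, y and z
   components of d/dz + c E4, with c chosen so that Omega kills E3. *)
pose N := ch g v j j0 ^+ 2 + ch g v j j1 ^+ 2.
have N0 : N != 0 by rewrite /N paddr_eq0 ?sqr_ge0 // negb_and !sqrf_eq0.
pose c := - cc g v j 0 / N.
apply: (evaluate_mod4 (X := hor v x y) (E1 := vertical k p1 q1 s1)
  (E2 := vertical k p2 q2 s2)
  (E3 := tangent k (c * ch g v j j0) (c * ch g v j j1)
     (1 + lsubmx v 0 jp * (c * ch g v j j0) + lsubmx v 0 jq * (c * ch g v j j1)) 0 0 0)
  (E4 := hor v (ch g v j j0) (ch g v j j1)) _ _ _ _ w0).
- exact: covector_theta_row.
- exact: covector_theta_row.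
- exact/covectorZ/covector_lambda.
- exact: covector_Omega_row.
- by move=> Z; rewrite !inE => /orP[] /eqP -> //; exact: theta_row_hor.
- by move=> Z; rewrite !inE => /or3P[] /eqP -> //; exact: theta_row_hor.
- move=> Z; rewrite !inE theta4_pairing => /or4P[] /eqP ->;
    by rewrite ?lambda_hor ?lambda_vertical mulr0.
- move=> Z; rewrite !inE Omega_row_pairing.
  case/or4P => [/eqP ->|/eqP ->|/eqP ->|/orP[] /eqP ->].
  + by rewrite lambda_hor !tangentE mulr0 add0r.
  + by rewrite lambda_vertical !tangentE !mulr0 !addr0.
  + by rewrite lambda_vertical !tangentE !mulr0 !addr0.
  + by rewrite lambda_vertical !tangentE !mulr0 !addr0.
  + rewrite pairing_lambda !tangentE.
    transitivity (cc g v j 0 + c * N); first by rewrite /N; ring.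
    by rewrite /c divfK // subrr.
- by [].
- by [].
- rewrite theta4_pairing pairing_lambda !tangentE mulf_neq0 //.
  by rewrite (_ : _ - _ = 1) ?oner_neq0 //; ring.
- by rewrite Omega_row_pairing lambda_hor !tangentE mulr0 add0r -!expr2.
Qed.

(* D is the domain of a chart over U, in which the lifted forms are written. *)
Variables (U : set 'rV[K]_6) (D : set 'rV[K]_(6 + k)).
Hypotheses (R_smooth : smooth_on U R) (T_smooth : smooth_on U T).
Hypotheses (D_open : open D) (D_over : forall v, D v -> U (lsubmx v)).
Hypotheses (ca_diff : forall v, D v -> differentiable (ca g) v).
Hypotheses (cb_diff : forall i v, D v -> differentiable (fun u => cb g u i 0) v).
Hypotheses (cf_diff : forall i j v, D v -> differentiable (fun u => cf g u i j) v).
Hypothesis nondegenerate :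
  forall v, D v -> ca g v * \det (cf g v) * \det (ch g v) != 0.
Hypothesis equations : forall v, D v -> structure_equations R T DyR DxT g v.

Let R_diff v : D v -> differentiable R (lsubmx v).
Proof. by move=> Dv; apply: (R_smooth [::]); exact: D_over. Qed.

Let T_diff v : D v -> differentiable T (lsubmx v).
Proof. by move=> Dv; apply: (T_smooth [::]); exact: D_over. Qed.

Let ca_neq0 v : D v -> ca g v != 0.
Proof. by move/nondegenerate; rewrite !mulf_eq0 !negb_or => /andP[/andP[]]. Qed.

Let ch_neq0 v : D v -> ch g v j0 j0 * ch g v j1 j1 - ch g v j0 j1 * ch g v j1 j0 != 0.
Proof.
by move/nondegenerate; rewrite !mulf_eq0 !negb_or det_mx2 => /andP[].
Qed.

Let ch_row0 v : D v -> (ch g v j0 j0 != 0) || (ch g v j0 j1 != 0).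
Proof.
move=> Dv; rewrite -negb_and; apply: contraNN (ch_neq0 Dv) => /andP[/eqP -> /eqP ->].
by rewrite !mul0r subr0.
Qed.

Let ch_row1 v : D v -> (ch g v j1 j0 != 0) || (ch g v j1 j1 != 0).
Proof.
move=> Dv; rewrite -negb_and; apply: contraNN (ch_neq0 Dv) => /andP[/eqP -> /eqP ->].
by rewrite !mulr0 subr0.
Qed.

(** The first structure equation, evaluated on x D_x + y D_y and a vertical vector. *)
Lemma contact_equation v x y p q s : D v ->
  ca g v * (p * x + q * y) =
  (ch g v j1 j0 * x + ch g v j1 j1 * y)
    * (cf g v i0 i0 * p + cf g v i0 i1 * q + cf g v i0 i2 * s)
  + (ch g v j0 j0 * x + ch g v j0 j1 * y)
    * (cf g v i1 i0 * p + cf g v i1 i1 * q + cf g v i1 i2 * s).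
Proof.
move=> Dv; have [E _ _ _ _] := equations Dv.
have := congr1 (fun t => evaluate t
  [:: hor v x y; vertical k p q s; tangent k 0 0 1 0 0 0]) E.
have c4 : covector (theta4 g v) by exact/covectorZ/covector_lambda.
have n4 Z : Z \in [:: hor v x y; vertical k p q s] -> pairing (theta4 g v) Z = 0.
  rewrite !inE theta4_pairing => /orP[] /eqP ->;
    by rewrite ?lambda_hor ?lambda_vertical mulr0.
rewrite !(@evaluate_wedge_rcons _ _ [:: hor v x y; vertical k p q s]) //.
rewrite theta4_pairing pairing_lambda !tangentE !mulr0 !subr0 mulr1.
have sign0 : (-1) ^+ 2 * ca g v != 0 by rewrite mulf_neq0 ?signr_eq0 ?ca_neq0.
move/(mulfI sign0).
rewrite (_ : theta4 g = contact_form R T (ca g) (cst 0) (cst 0)); last first.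
  by apply/funext => u; rewrite /contact_form /= !scale0r !addr0.
rewrite evaluate_ext_d_contact //; [|exact: R_diff|exact: T_diff|exact: ca_diff].
rewrite -[(_ \+ _) v]/(_ v + _ v) evaluateD !evaluate_wedge2;
  try solve [exact: covector_theta_row|exact: covector_Omega_row].
rewrite !theta_row_hor !theta_row_vertical !Omega_row_pairing lambda_hor !tangentE.
rewrite !derive_cst !(mul0r, mulr0, addr0, add0r, sub0r).
by rewrite -opprD => /oppr_inj.
Qed.

(** The last two equations say that Omega_3 and Omega_2 kill the horizontal vectors
   whose components are the first, respectively the second row of the f_ij. *)
Lemma cf_column v : D v -> [/\ cf g v i0 i2 = 0, cf g v i1 i2 = 0,
  cf g v i0 i0 * cf g v i1 i1 - cf g v i0 i1 * cf g v i1 i0 != 0,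
  cf g v i2 i2 != 0 &
  ch g v j0 j0 * cf g v i0 i0 + ch g v j0 j1 * cf g v i0 i1 = 0 /\
  ch g v j1 j0 * cf g v i1 i0 + ch g v j1 j1 * cf g v i1 i1 = 0].
Proof.
move=> Dv; have [z0 z1 hF] := block_structure (ch_neq0 Dv)
  (fun x y p q s => contact_equation x y p q s Dv).
have : \det (cf g v) != 0.
  by move: (nondegenerate Dv); rewrite !mulf_eq0 !negb_or => /andP[/andP[]].
rewrite det_mx3_col // mulf_eq0 negb_or => /andP[d0 f0].
by split => //; exact: hF.
Qed.

(** The coefficient f_i3 has to vanish on the whole domain [D], because theta^i is
   differentiated. *)
Lemma evaluate_ext_d_row v (i : 'I_3) x y p q s : D v ->
  (forall u, D u -> cf g u i i2 = 0) ->
  let d F := p * partial jp F (lsubmx v) + q * partial jq F (lsubmx v)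
              + s * partial js F (lsubmx v) in
  evaluate (ext_d (theta i) v) [:: hor v x y; vertical k p q s] =
  - (cb g v i 0 * (p * x + q * y) + cf g v i i0 * (d R * x + s * y)
     + cf g v i i1 * (s * x + d T * y)
     + 'D_(hor v x y) (fun u => cf g u i i0) v * p
     + 'D_(hor v x y) (fun u => cf g u i i1) v * q).
Proof.
move=> Dv fi; rewrite (@ext_d_near _ _ _ (contact_form R T (fun u => cb g u i 0)
  (fun u => cf g u i i0) (fun u => cf g u i i1))).
  rewrite evaluate_ext_d_contact //.
  - exact: R_diff.
  - exact: T_diff.
  - exact: cb_diff.
  - exact: cf_diff.
  - exact: cf_diff.
have := open_nbhs_nbhs (conj D_open Dv); apply: filterS => u Du.
by rewrite /theta_row fi // scale0r addr0.
Qed.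

Let Rs (u : 'rV[K]_(6 + k)) := partial js R (lsubmx u).
Let Ts (u : 'rV[K]_(6 + k)) := partial js T (lsubmx u).

(** The second and third structure equations, evaluated on the horizontal vector
   given by a row and on d/ds. *)
Lemma null_rows v : D v ->
  Rs v * cf g v i0 i0 ^+ 2 + 2 * cf g v i0 i0 * cf g v i0 i1
    + Ts v * cf g v i0 i1 ^+ 2 = 0 /\
  Rs v * cf g v i1 i0 ^+ 2 + 2 * cf g v i1 i0 * cf g v i1 i1
    + Ts v * cf g v i1 i1 ^+ 2 = 0.
Proof.
move=> Dv; have [f02 f12 d0 f22 [h0 h1]] := cf_column Dv.
have [_ E0 E1 _ _] := equations Dv.
have {}E0 := evaluate_mod_coframe
  (p := 0) (q := 0) (s := 1)
  (p1 := cf g v i1 i1) (q1 := - cf g v i1 i0) (s1 := 0)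
  (p2 := - cf g v i0 i1) (q2 := cf g v i0 i0) (s2 := 0)
  E0 (ca_neq0 Dv) (ch_row0 Dv) h0.
have {}E1 := evaluate_mod_coframe
  (p := 0) (q := 0) (s := 1)
  (p1 := cf g v i1 i1) (q1 := - cf g v i1 i0) (s1 := 0)
  (p2 := - cf g v i0 i1) (q2 := cf g v i0 i0) (s2 := 0)
  E1 (ca_neq0 Dv) (ch_row1 Dv) h1.
have Y0 : pairing (theta i0 v) (vertical k 0 0 1) = 0.
  by rewrite theta_row_vertical f02 !(mulr0, mulr1, addr0).
have Y1 : pairing (theta i1 v) (vertical k 0 0 1) = 0.
  by rewrite theta_row_vertical f12 !(mulr0, mulr1, addr0).
have E10 : pairing (theta i1 v)
    (vertical k (cf g v i1 i1) (- cf g v i1 i0) 0) = 0.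
  by rewrite theta_row_vertical; ring.
have E11 : pairing (theta i0 v)
    (vertical k (cf g v i1 i1) (- cf g v i1 i0) 0) != 0.
  by rewrite theta_row_vertical mulr0 addr0 mulrN.
have E20 : pairing (theta i1 v)
    (vertical k (- cf g v i0 i1) (cf g v i0 i0) 0) != 0.
  rewrite theta_row_vertical; apply: contra_neq d0 => <-; ring.
have {}E0 := E0 Y0 Y1 E10 E11 E20.
have {}E1 := E1 Y0 Y1 E10 E11 E20.
rewrite evaluate_ext_d_row // in E0; last by move=> u /cf_column[].
rewrite evaluate_ext_d_row // in E1; last by move=> u /cf_column[].
move: E0 E1; rewrite !(mul0r, mulr0, add0r, addr0, mul1r) -/(Rs v) -/(Ts v).
by move=> E0 E1; split; apply: oppr_inj; rewrite oppr0;
  [rewrite -[RHS]E0|rewrite -[RHS]E1]; ring.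
Qed.

(** The derivative of the null condition along x D_x + y D_y. *)
Lemma derive_null_row v i x y : D v ->
  (forall u, D u -> Rs u * cf g u i i0 ^+ 2 + 2 * cf g u i i0 * cf g u i i1
    + Ts u * cf g u i i1 ^+ 2 = 0) ->
  2 * (Rs v * cf g v i i0 + cf g v i i1) * 'D_(hor v x y) (fun u => cf g u i i0) v
  + 2 * (cf g v i i0 + Ts v * cf g v i i1) * 'D_(hor v x y) (fun u => cf g u i i1) v
  + cf g v i i0 ^+ 2 * (x * Dx R DyR (partial js R) (lsubmx v)
                        + y * Dy T DxT (partial js R) (lsubmx v))
  + cf g v i i1 ^+ 2 * (x * Dx R DyR (partial js T) (lsubmx v)
                        + y * Dy T DxT (partial js T) (lsubmx v)) = 0.
Proof.
move=> Dv Q; set X := hor v x y.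
set F1 := fun u => cf g u i i0; set F2 := fun u => cf g u i i1.
have Rs_diff : differentiable (partial js R) (lsubmx v).
  by apply: (R_smooth [:: js]); exact: D_over.
have Ts_diff : differentiable (partial js T) (lsubmx v).
  by apply: (T_smooth [:: js]); exact: D_over.
have iR := is_derive_jet X Rs_diff; rewrite derive_total_direction // in iR.
have iT := is_derive_jet X Ts_diff; rewrite derive_total_direction // in iT.
have iF1 : is_derive v X F1 ('D_X F1 v) by exact/derivableP/diff_derivable/cf_diff.
have iF2 : is_derive v X F2 ('D_X F2 v) by exact/derivableP/diff_derivable/cf_diff.
have iQ := is_deriveD (is_deriveD (is_deriveM iR (is_deriveM iF1 iF1))
  (is_deriveZ 2 (is_deriveM iF1 iF2))) (is_deriveM iT (is_deriveM iF2 iF2)).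
rewrite -[RHS](@derive_cst K _ _ 0 v X).
rewrite -[RHS](@near_eq_derive _ _ _
  (Rs * (F1 * F1) + 2 *: (F1 * F2) + Ts * (F2 * F2)) (cst 0) v X); last first.
  have := open_nbhs_nbhs (conj D_open Dv); apply: filterS => u Du.
  rewrite -[RHS](Q u Du).
  rewrite -[LHS]/(Rs u * (F1 u * F1 u) + 2 * (F1 u * F2 u) + Ts u * (F2 u * F2 u)).
  by rewrite /F1 /F2; ring.
rewrite [RHS](@derive_val _ _ _ _ _ _ _ iQ).
have sE (c d : K) : c *: d = c * d by [].
rewrite !sE -![(_ * _) v]/(_ v * _ v).
rewrite -/(F1 v) -/(F2 v) /Rs /Ts.
move: ('D_X F1 v) ('D_X F2 v) (F1 v) (F2 v)
  (Dx _ _ (partial js R) _) (Dx _ _ (partial js T) _)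
  (Dy _ _ (partial js R) _) (Dy _ _ (partial js T) _) => *.
by ring.
Qed.

(** The fourth (i = 1, Omega_3) and fifth (i = 2, Omega_2) structure equations; the
   row i' is the other one. *)
Lemma cubic_row (i i' : 'I_3) (j : 'I_2) v : D v ->
  (forall u, D u -> cf g u i i2 = 0) ->
  (forall u, D u -> Rs u * cf g u i i0 ^+ 2 + 2 * cf g u i i0 * cf g u i i1
    + Ts u * cf g u i i1 ^+ 2 = 0) ->
  cf g v i i0 * cf g v i' i1 - cf g v i i1 * cf g v i' i0 != 0 ->
  (ch g v j j0 != 0) || (ch g v j j1 != 0) ->
  ch g v j j0 * cf g v i i0 + ch g v j j1 * cf g v i i1 = 0 ->
  (ext_d (theta i) \wedge theta i \wedge theta i2 \wedge theta4 g
     \wedge Omega_row g j) v = 0 ->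
  let F1 := cf g v i i0 in let F2 := cf g v i i1 in
  let P := lsubmx v in
  let R_p := partial jp R P in let R_q := partial jq R P in
  let T_p := partial jp T P in let T_q := partial jq T P in
  let R_s := partial js R P in let T_s := partial js T P in
  (2 * R_q + 2 * R_p * R_s - Dx R DyR (partial js R) P) * F1 ^+ 3
  + (2 * R_q * T_s + 2 * R_p - Dy T DxT (partial js R) P) * F1 ^+ 2 * F2
  + (2 * T_q + 2 * T_p * R_s - Dx R DyR (partial js T) P) * F1 * F2 ^+ 2
  + (2 * T_q * T_s + 2 * T_p - Dy T DxT (partial js T) P) * F2 ^+ 3 = 0.
Proof.
move=> Dv fi Q d0 h0 hF E F1 F2 P R_p R_q T_p T_q R_s T_s.
have [_ _ _ f22 _] := cf_column Dv.
(* The vertical vector (p, q, sig p q) is killed by theta^3. *)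
pose sig p q := - (cf g v i2 i0 * p + cf g v i2 i1 * q) / cf g v i2 i2.
have sigP p q : cf g v i2 i0 * p + cf g v i2 i1 * q + cf g v i2 i2 * sig p q = 0.
  by rewrite /sig [cf g v i2 i2 * _]mulrC divfK // subrr.
have := evaluate_mod_coframe
  (p := - F2) (q := F1) (s := sig (- F2) F1)
  (p1 := cf g v i' i1) (q1 := - cf g v i' i0) (s1 := sig (cf g v i' i1) (- cf g v i' i0))
  (p2 := 0) (q2 := 0) (s2 := 1)
  E (ca_neq0 Dv) h0 hF.
rewrite !theta_row_vertical (fi v Dv) !sigP !(mul0r, mulr0, add0r, addr0, mulr1).
rewrite evaluate_ext_d_row // => E0.
have f0 : (F1 != 0) || (F2 != 0).
  rewrite -negb_and; apply: contraNN d0 => /andP[/eqP F10 /eqP F20].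
  by rewrite -/F1 -/F2 F10 F20 !mul0r subr0.
apply: (cubic_of_null_row (s := sig (- F2) F1) f0 (Q v Dv)
  (derive_null_row F1 F2 Dv Q)).
have Y0 : F1 * - F2 + F2 * F1 = 0 by ring.
have d1 : F1 * cf g v i' i1 + F2 * - cf g v i' i0 != 0 by rewrite mulrN.
have {E0} := E0 Y0 erefl erefl d1 f22.
rewrite -/F1 -/F2 -/P -/R_p -/R_q -/T_p -/T_q -/R_s -/T_s -[Rs v]/R_s -[Ts v]/T_s.
move: ('D_(hor v F1 F2) (fun u => cf g u i i0) v)
  ('D_(hor v F1 F2) (fun u => cf g u i i1) v) => dF1 dF2 E0.
by apply: oppr_inj; rewrite oppr0 -[RHS]E0; ring.
Qed.

Lemma J_eq0 v : D v ->
  J1 R T DyR DxT (lsubmx v) = 0 /\ J2 R T DyR DxT (lsubmx v) = 0.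
Proof.
move=> Dv; have [_ _ d0 _ [h0 h1]] := cf_column Dv.
have [_ _ _ E0 E1] := equations Dv.
have P0 := cubic_row Dv (fun u Du => (let: And5 h _ _ _ _ := cf_column Du in h))
  (fun u Du => (null_rows Du).1) d0 (ch_row0 Dv) h0 E0.
have d0' : cf g v i1 i0 * cf g v i0 i1 - cf g v i1 i1 * cf g v i0 i0 != 0.
  by rewrite -oppr_eq0 opprB mulrC [X in _ - X]mulrC.
have P1 := cubic_row Dv (fun u Du => (let: And5 _ h _ _ _ := cf_column Du in h))
  (fun u Du => (null_rows Du).2) d0' (ch_row1 Dv) h1 E1.
have [Q0 Q1] := null_rows Dv.
have [e1 e2] := cubic_vanishing d0 Q0 Q1 P0 P1.
rewrite /J1 /J2; move: e1 e2; rewrite /Rs /Ts.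
move: (partial jp R _) (partial jq R _) (partial js R _) (partial jp T _)
  (partial jq T _) (partial js T _)
  (Dx _ _ _ _) (Dx _ _ _ _) (Dy _ _ _ _) (Dy _ _ _ _).
move=> Rp Rq rs Tp Tq ts DxTs DxRs DyTs DyRs.
move=> /eqP; rewrite -subr_eq0 => /eqP e1 /eqP; rewrite -subr_eq0 => /eqP e2.
by split; [rewrite -[RHS]e1|rewrite -[RHS]e2]; ring.
Qed.
End chart_argument.

Theorem theorem7p5 (K : realType) (U : set 'rV[K]_6)
    (R T DyR DxT : 'rV[K]_6 -> K)
    (U_open : open U) (R_smooth : smooth_on U R) (T_smooth : smooth_on U T)
    (D_system : total_derivative_system U R T DyR DxT)
    (compatible : forall P, U P ->
       Dx R DyR (Dx R DyR T) P = Dy T DxT (Dy T DxT R) P)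
    (hyperbolic : forall P, U P -> 0 < 1 - partial js R P * partial js T P) :
  admits_lifted_forms U R T DyR DxT ->
  (forall P, U P -> J1 R T DyR DxT P = 0) /\
  (forall P, U P -> J2 R T DyR DxT P = 0).
Proof.
case=> k [M [g [[sa sb _ sf _] nd eqs]]].
suff J P : U P -> J1 R T DyR DxT P = 0 /\ J2 R T DyR DxT P = 0.
  by split=> P /J[].
move=> UP; have : range (base_point (f := M)) P by rewrite base_point_onto.
case=> m _ <-; have [i [v Dv <-]] := charts_cover m.
rewrite charts_adapted //.
apply: (@J_eq0 K k R T DyR DxT (pull_coefficients (param i) g) U (dom i)) => //.
- exact: dom_open.
- move=> u Du; have : range (base_point (f := M)) (base_point (param i u)).
    by exists (param i u).
  by rewrite base_point_onto charts_adapted.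
- by move=> u Du; exact: (sa i [::]).
- by move=> a u Du; exact: (sb a i [::]).
- by move=> a b u Du; exact: (sf a b i [::]).
- by move=> u Du; exact: nd.
- by move=> u Du; exact: eqs.
Qed.
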